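(* Let $q$ be a prime power and $k,h\ge 1$ integers. Let $\mathcal P_h$ be a pseudo-arc of $\mathrm{PG}(kh-1,q)$ of size $k+1$, consisting of $(h-1)$-dimensional subspaces, and let $\mathcal D_h$, $\mathcal D_h'$ be distinct Desarguesian $(h-1)$-spreads of $\mathrm{PG}(kh-1,q)$ such that $\mathcal P_h\subset \mathcal D_h\cap\mathcal D_h'$. Then there is a proper divisor $r$ of $h$ (that is, $r\mid h$ and $1\le r<h$) such that $$|\mathcal D_h\cap\mathcal D_h'|=\frac{q^{kr}-1}{q^r-1}.$$ Moreover, $\mathcal D_h\cap\mathcal D_h'=\mathcal R^r_{h,q}$, where $\mathcal R^r_{h,q}$ is the system of $(h-1)$-dimensional subspaces of a generalized Segre variety $\mathcal S^r_{kr-1,h-1}(q)$ of $\mathrm{PG}(kh-1,q)$.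
   Context: All dimensions of subspaces are projective. A pseudo-arc of $\mathrm{PG}(kh-1,q)$ is a set of $(h-1)$-dimensional subspaces such that every $k$ of them span the whole space. An $(h-1)$-spread of $\mathrm{PG}(kh-1,q)$ is a partition of its point set into $(h-1)$-dimensional subspaces. Desarguesian spreads: let $\Sigma\simeq \mathrm{PG}(kh-1,q)$ be embedded as a $q$-order subgeometry of $\mathrm{PG}(kh-1,q^h)$ as the set of fixed points of a semilinear collineation $\Psi$ of order $h$. Let $\Theta$ be a $(k-1)$-dimensional subspace of $\mathrm{PG}(kh-1,q^h)$ such that $\Theta,\Theta^\Psi,\dots,\Theta^{\Psi^{h-1}}$ span $\mathrm{PG}(kh-1,q^h)$. Then $\mathcal L(\Theta)=\{\langle P,P^\Psi,\dots,P^{\Psi^{h-1}}\rangle_{q^h}\cap\Sigma : P\in\Theta\}$ is an $(h-1)$-spread of $\Sigma$. An $(h-1)$-spread of $\mathrm{PG}(kh-1,q)$ is Desarguesian if it is projectively equivalent (under $\mathrm{PGL}$) to some $\mathcal L(\Theta)$. (Equivalently: it is obtained by viewing the one-dimensional $\mathbb F_{q^h}$-subspaces of $\mathbb F_{q^h}^k$ as $h$-dimensional $\mathbb F_q$-subspaces of $\mathbb F_{q^h}^k\simeq\mathbb F_q^{kh}$.) Generalized Segre variety: for $v\in\mathbb F_{q^h}^k$ let $v^\sigma$ be obtained by raising every entry to the $q$-th power, and let $M_v$ be the $h\times k$ Moore matrix with rows $v,v^\sigma,\dots,v^{\sigma^{h-1}}$. The set $\mathcal M=\{M_v: v\in\mathbb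 F_{q^h}^k\}$ is a $kh$-dimensional $\mathbb F_q$-vector space; let $\Pi\simeq\mathrm{PG}(kh-1,q)$ be the associated projective space. For $v\ne \mathbf 0$ let $\pi_v$ be the $(h-1)$-dimensional subspace of $\Pi$ whose points are represented by $M_{\alpha v}$, $\alpha\in\mathbb F_{q^h}\setminus\{0\}$. For a proper divisor $r$ of $h$, put $\mathcal R^r_{h,q}=\{\pi_v : v\in\mathbb F_{q^r}^k\setminus\{\mathbf 0\}\}$, and let $\mathcal S^r_{kr-1,h-1}(q)$ be the set of points of $\Pi$ lying on the elements of $\mathcal R^r_{h,q}$. In an arbitrary $\mathrm{PG}(kh-1,q)$, a generalized Segre variety and its system $\mathcal R^r_{h,q}$ are the images of these objects under a projectivity (isomorphism induced by an $\mathbb F_q$-linear bijection) from $\Pi$ to $\mathrm{PG}(kh-1,q)$. *)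

(* Defs.v *)
From HB Require Import structures.
From mathcomp Require Import all_boot all_order all_algebra all_field.
From mathcomp Require Import finmap.

Set Implicit Arguments.
Unset Strict Implicit.
Unset Printing Implicit Defensive.

Import GRing.Theory.
Local Open Scope fset_scope.
Local Open Scope ring_scope.

(* PG(kh-1, q) is modelled by the row space 'rV[F]_(k * h) over a finite field
   F of order q: an m-dimensional projective subspace is a {vspace _} of linear
   dimension m + 1.  The field F_{q^h} is an extension L of F of degree h. *)

Section ProjectiveSpace.
Variables (F : finFieldType) (k h : nat).
Local Notation V := 'rV[F]_(k * h).

Definition pseudo_arc (P : {fset {vspace V}}) : Prop :=
  (forall W, W \in P -> \dim W = h) /\
  (forall A : {fset {vspace V}}, A `<=` P -> #|` A| = k ->
     (\sum_(W <- A) W)%VS = fullv).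

Definition spread (D : {fset {vspace V}}) : Prop :=
  (forall W, W \in D -> \dim W = h) /\
  (forall p : {vspace V}, \dim p = 1%N ->
     exists! W, W \in D /\ (p <= W)%VS).

End ProjectiveSpace.

Section Desarguesian.
Variables (F : finFieldType) (L : fieldExtType F) (k h : nat).
Local Notation n := (k * h)%N.
Local Notation V := 'rV[F]_n.
Local Notation VL := 'rV[L]_n.

(* For E invertible, the points <embed E w> with w != 0 form the subgeometry
   of order q of PG(kh-1, q^h) determined by the L-basis of rows of E. *)
Definition embed (E : 'M[L]_n) (w : V) : VL := map_mx (in_alg L) w *m E.

Definition fixes_point (f : VL -> VL) (x : VL) : Prop :=
  exists a : L, f x = a *: x.

(* The order of the collineation induced on points by f. *)
Definition collineation_order (f : VL -> VL) (m : nat) : Prop :=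
  [/\ (0 < m)%N, forall x, fixes_point (iter m f) x &
      forall j, (0 < j < m)%N -> ~ (forall x, fixes_point (iter j f) x)].

Definition fixed_subgeometry (f : VL -> VL) (E : 'M[L]_n) : Prop :=
  forall x : VL, x != 0 ->
    (fixes_point f x <-> exists (b : L) (w : V), x = b *: embed E w).

(* The image of U under f, when f is semilinear and bijective. *)
Definition semilinear_img (f : VL -> VL) (U : {vspace VL}) : {vspace VL} :=
  <<[seq f u | u <- vbasis U]>>%VS.

(* <P, P^Psi, .., P^(Psi^(h-1))> for the point P = <u>. *)
Definition orbit_span (f : VL -> VL) (u : VL) : {vspace VL} :=
  <<[seq iter i f u | i <- iota 0 h]>>%VS.

(* S is L(Theta), its elements being read in V through embed E. *)
Definition is_L_Theta (f : VL -> VL) (E : 'M[L]_n) (Theta : {vspace VL})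
    (S : {fset {vspace V}}) : Prop :=
  forall W, W \in S <->
    exists u : VL, [/\ u \in Theta, u != 0 &
      forall w : V, (w \in W) = (embed E w \in orbit_span f u)].

Definition L_spread (S : {fset {vspace V}}) : Prop :=
  exists (E : 'M[L]_n) (tau : {rmorphism L -> L})
         (Psi : {linear VL -> VL | tau \; *:%R}) (Theta : {vspace VL}),
    [/\ E \in unitmx,
        [/\ bijective Psi, collineation_order Psi h & fixed_subgeometry Psi E],
        \dim Theta = k,
        (\sum_(i < h) semilinear_img (iter i Psi) Theta)%VS = fullv &
        is_L_Theta Psi E Theta S].

Definition desarguesian_spread (D : {fset {vspace V}}) : Prop :=
  spread D /\
  exists (S : {fset {vspace V}}) (g : 'End(V)),
    [/\ L_spread S, lker g == 0%VS & D = [fset (g @: W)%VS | W in S]].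

End Desarguesian.

Section GeneralizedSegre.
Variables (F : finFieldType) (L : fieldExtType F) (k h : nat).
Local Notation V := 'rV[F]_(k * h).

Definition moore (v : 'rV[L]_k) : 'M[L]_(h, k) :=
  \matrix_(i < h, j < k) v 0 j ^+ (#|F| ^ i).

Definition is_moore (A : 'M[L]_(h, k)) : Prop := exists v, A = moore v.

(* phi restricts to an F-linear bijection from the space of Moore matrices
   onto V; its values elsewhere are irrelevant. *)
Definition moore_projectivity (phi : 'M[L]_(h, k) -> V) : Prop :=
  (forall (c : F) A B, is_moore A -> is_moore B ->
     phi (c%:A *: A + B) = c *: phi A + phi B) /\
  (forall w : V, exists! A, is_moore A /\ phi A = w).

(* W is the image under phi of the subspace pi_v. *)
Definition is_pi_img (phi : 'M[L]_(h, k) -> V) (v : 'rV[L]_k)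
    (W : {vspace V}) : Prop :=
  forall w : V, w \in W <-> exists alpha : L, w = phi (moore (alpha *: v)).

(* v has its entries in the subfield of L of order q^r. *)
Definition over_subfield (r : nat) (v : 'rV[L]_k) : Prop :=
  exists2 K : {subfield L}, \dim K = r & forall j, v 0 j \in K.

(* R is the system R^r_{h,q}, and S the point set S^r_{kr-1,h-1}(q), of a
   generalized Segre variety of PG(kh-1, q). *)
Definition gen_segre_system (r : nat) (S R : {fset {vspace V}}) : Prop :=
  exists phi : 'M[L]_(h, k) -> V,
    [/\ moore_projectivity phi,
        forall W, W \in R <->
          exists v, [/\ v != 0, over_subfield r v & is_pi_img phi v W] &
        forall p : {vspace V}, p \in S <->
          \dim p = 1%N /\ exists2 W, W \in R & (p <= W)%VS].

End GeneralizedSegre.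

(* Main.v *)
(* A Desarguesian spread is the set of images phi(L v) of the L-lines of L^k
   (L = F_(q^h)) under an F-linear bijection phi: after rescaling, the
   collineation Psi is an entrywise field automorphism N in the coordinates of
   the subgeometry, and phi v is the trace sum_(i < h) N^i of the point of Theta
   with coordinates v.
   Composing with an element of GL_k(L), the k + 1 elements of the pseudo-arc
   become the images of the standard frame of L^k.  If phi and phi' are so
   normalised for D and D', then phi'^-1 phi maps every line L e_i and L (1,..,1)
   to itself, hence acts as one F-linear map A, with A 1 = 1, on all coordinates.
   A line L v, scaled so that some v_j = 1, gives an element of both spreads iff
   A (l v_i) = A l * A v_i for all l and i, that is, iff v has its entries in the
   subfield K = {x | forall l, A (l x) = A l * A x}; if K = L then D = D'. *)
Require Import Defs.
From HB Require Import structures.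
From mathcomp Require Import all_boot all_order all_algebra all_field.
From mathcomp Require Import finmap.

Set Implicit Arguments.
Unset Strict Implicit.
Unset Printing Implicit Defensive.

Import GRing.Theory.
Local Open Scope fset_scope.
Local Open Scope ring_scope.

(** * Lines of [L^k] read in [V] through an F-linear bijection *)

Section FieldModels.
Variables (F : finFieldType) (L : fieldExtType F) (k n : nat).
Local Notation V := 'rV[F]_n.
Local Notation LK := 'rV[L]_k.

Definition F_linear (phi : LK -> V) : Prop :=
  forall (c : F) u v, phi (c%:A *: u + v) = c *: phi u + phi v.

(** [linfun] records the values on a basis of [L] only, so this image is meaningful for an F-linear
    [phi]; [mem_L_line] then describes it. *)
Definition L_line (phi : LK -> V) (v : LK) : {vspace V} :=
  limg (linfun (fun a : L => phi (a *: v))).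

Definition field_model (phi : LK -> V) (D : {fset {vspace V}}) : Prop :=
  [/\ F_linear phi, bijective phi &
      forall W, W \in D <-> exists2 v, v != 0 & W = L_line phi v].

Section FLinear.
Variables (phi : LK -> V) (phi_lin : F_linear phi).

Lemma F_linear0 : phi 0 = 0.
Proof.
have := phi_lin (-1) 0 0; rewrite scaler0 addr0 scaleN1r addNr.
by move=> ->.
Qed.

Lemma F_linearD : {morph phi : u v / u + v}.
Proof. by move=> u v; have := phi_lin 1 u v; rewrite !scale1r. Qed.

Lemma F_linear_sum I (r : seq I) (P : pred I) (G : I -> LK) :
  phi (\sum_(i <- r | P i) G i) = \sum_(i <- r | P i) phi (G i).
Proof. exact: (big_morph phi F_linearD F_linear0). Qed.

Lemma mem_L_line v w :
  reflect (exists a : L, w = phi (a *: v)) (w \in L_line phi v).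
Proof.
have lin_f : linear (fun a : L => phi (a *: v)).
  move=> c a b /=; rewrite scalerDl -phi_lin; congr (phi (_ + _)).
  by rewrite scalerA mulr_algl.
pose fM := GRing.isLinear.Build F L V *:%R _ lin_f.
pose f : {linear L -> V} := HB.pack (fun a : L => phi (a *: v)) fM.
have fE a : linfun (fun a : L => phi (a *: v)) a = phi (a *: v).
  exact: (lfunE f a).
apply: (iffP memv_imgP) => [[a _ ->]|[a ->]]; exists a; rewrite ?memvf //.
Qed.

Lemma L_line_mem v : phi v \in L_line phi v.
Proof. by apply/mem_L_line; exists 1; rewrite scale1r. Qed.

Lemma L_line_scale a v : a != 0 -> L_line phi (a *: v) = L_line phi v.
Proof.
move=> a0; apply/vspaceP => w; apply/mem_L_line/mem_L_line => -[b ->].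
  by exists (b * a); rewrite scalerA.
by exists (b / a); rewrite scalerA divfK.
Qed.

Lemma L_line_inj u v : injective phi -> u != 0 ->
  L_line phi u = L_line phi v -> exists2 a, a != 0 & u = a *: v.
Proof.
move=> phi_inj u0 eq_uv; have := L_line_mem u; rewrite eq_uv.
case/mem_L_line => a /phi_inj ua; exists a => //.
by apply: contra_neq u0 => a0; rewrite ua a0 scale0r.
Qed.

End FLinear.
End FieldModels.

(** * Normal form of a collineation that fixes a subgeometry *)

Section SemilinearNormalForm.
Variables (F : finFieldType) (L : fieldExtType F) (k h : nat).
Local Notation n := (k * h)%N.
Local Notation V := 'rV[F]_n.
Local Notation VL := 'rV[L]_n.
Variables (E : 'M[L]_n) (tau : {rmorphism L -> L}).
Variable Psi : {linear VL -> VL | tau \; *:%R}.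

(** As all points of the subgeometry are fixed, comparing two coordinates shows that [Psi]
    multiplies every row of [E] by the same scalar [a0] and that [tau] fixes F. Dividing by [a0]
    leaves [N], which is [tau] applied entrywise in the coordinates of [E]. *)
Lemma semilinear_normal_form :
  (1 < n)%N -> E \in unitmx -> injective Psi ->
  collineation_order Psi h -> fixed_subgeometry Psi E ->
  exists (N : {linear VL -> VL | tau \; *:%R}) (b : nat -> L),
    [/\ forall i, b i != 0, forall i x, iter i Psi x = b i *: iter i N x,
        forall c : F, tau c%:A = c%:A,
        forall x, N x = x <-> exists w, x = embed E w &
        forall x, iter h N x = x].
Proof.
move=> n_gt1 Eu Psi_inj [_ ordPsi _] fixPsi.
pose j0 : 'I_n := Ordinal (ltnW n_gt1); pose j1 : 'I_n := Ordinal n_gt1.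
have E_inj : injective (mulmx^~ E : VL -> VL) := can_inj (mulmxK Eu).
have E_eq0 (y : VL) : (y *m E == 0) = (y == 0) by rewrite -(inj_eq E_inj) mul0mx.
(* Test vectors: coordinate [j0] reads off the factor by which a vector is multiplied, and
   coordinate [j] then recovers [c]. *)
pose y2 j (c : L) : VL := 'e_j0 + c *: 'e_j.
have y2_j0 j c : j != j0 -> y2 j c 0 j0 = 1.
  by move=> jj0; rewrite !mxE !eqxx eq_sym (negPf jj0) mulr0 addr0.
have y2_j j c : j != j0 -> y2 j c 0 j = c.
  by move=> jj0; rewrite !mxE !eqxx (negPf jj0) add0r mulr1.
have y2_neq0 j c : j != j0 -> y2 j c *m E != 0.
  move=> jj0; rewrite E_eq0; apply/rV0Pn; exists j0.
  by rewrite y2_j0 ?oner_eq0.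
have fix_embed w : fixes_point Psi (embed E w).
  have [->|w0] := eqVneq (embed E w) 0.
    by exists 0; rewrite scale0r linear0.
  by apply/fixPsi => //; exists 1, w; rewrite scale1r.
have embed_e j : embed E 'e_j = 'e_j *m E.
  by rewrite /embed map_delta_mx.
have embed_y2 j (c : F) : embed E ('e_j0 + c *: 'e_j) = y2 j c%:A *m E.
  by rewrite /embed map_mxD map_mxZ !map_delta_mx.
have [a0 Psi_j0] := fix_embed 'e_j0; rewrite embed_e in Psi_j0.
have a0_neq0 : a0 != 0.
  apply: contraTneq (oner_neq0 L) => a00; rewrite negbK.
  have : ('e_j0 : VL) *m E = 0 by apply: Psi_inj; rewrite Psi_j0 a00 scale0r linear0.
  by move/eqP; rewrite E_eq0 => /eqP/rowP/(_ j0)/eqP; rewrite !mxE !eqxx.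
(* For [c = 1] this yields [a = a0]; then for any [c] it yields that [tau] fixes [c]. *)
have PsiF j (c : F) a : j != j0 -> Psi ('e_j *m E) = a *: ('e_j *m E) ->
    a0 * c%:A = tau c%:A * a.
  move=> jj0 Psi_j; have [d] := fix_embed ('e_j0 + c *: 'e_j).
  rewrite embed_y2 {1}/y2 mulmxDl -scalemxAl linearD linearZ /= Psi_j0 Psi_j.
  rewrite scalerA !scalemxAl -!mulmxDl scalemxAl => /E_inj/rowP Ed.
  have -> : a0 = d.
    have := Ed j0; rewrite !mxE !eqxx eq_sym (negPf jj0) !mulr0 !addr0 !mulr1.
    by [].
  by have := Ed j; rewrite !mxE !eqxx (negPf jj0) !mulr0 !add0r !mulr1.
have tauF (c : F) : tau c%:A = c%:A.
  have [a Psi_j1] := fix_embed 'e_j1; rewrite embed_e in Psi_j1.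
  have j10 : j1 != j0 by [].
  have := PsiF j1 1 a j10 Psi_j1; rewrite scale1r rmorph1 mulr1 mul1r => aE.
  have := PsiF j1 c a j10 Psi_j1; rewrite -aE mulrC.
  by move/(mulIf a0_neq0).
have Psi_e j : Psi ('e_j *m E) = a0 *: ('e_j *m E).
  have [-> //|jj0] := eqVneq j j0.
  have [a Psi_j] := fix_embed 'e_j; rewrite embed_e in Psi_j.
  have := PsiF j 1 a jj0 Psi_j; rewrite scale1r rmorph1 mulr1 mul1r => ->.
  exact: Psi_j.
have PsiE (y : VL) : Psi (y *m E) = a0 *: (map_mx tau y *m E).
  rewrite {1}(row_sum_delta y) mulmx_suml linear_sum /=.
  rewrite [map_mx tau y]row_sum_delta mulmx_suml scaler_sumr.
  apply: eq_bigr => j _; rewrite -!scalemxAl linearZ /= Psi_e mxE.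
  by rewrite !scalerA mulrC.
have N_lin : linear_for (tau \; *:%R) (fun x => a0^-1 *: Psi x).
  by move=> c x y; rewrite linearP /= scalerDr !scalerA mulrC.
have [N PsiN] : exists N : {linear VL -> VL | tau \; *:%R}, forall x, Psi x = a0 *: N x.
  pose NM := GRing.isLinear.Build L VL VL (tau \; *:%R) _ N_lin.
  pose N : {linear VL -> VL | tau \; *:%R} := HB.pack (fun x => a0^-1 *: Psi x) NM.
  exists N => x /=.
  by rewrite scalerA divff // scale1r.
have NE (y : VL) : N (y *m E) = map_mx tau y *m E.
  by apply: (scalerI a0_neq0); rewrite -PsiN PsiE.
have iterNE i (y : VL) : iter i N (y *m E) = map_mx (iter i tau) y *m E.
  elim: i => [|i IHi] /=; first by congr (_ *m E); apply/rowP => j; rewrite mxE.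
  by rewrite IHi NE; congr (_ *m E); apply/rowP => j; rewrite !mxE.
pose b := fix b i := if i is i'.+1 then tau (b i') * a0 else 1.
have b0 i : b i != 0.
  elim: i => [|i IHi] /=; first exact: oner_neq0.
  by rewrite mulf_neq0 // fmorph_eq0.
have bE i x : iter i Psi x = b i *: iter i N x.
  elim: i => [|i IHi] /=; first by rewrite scale1r.
  by rewrite IHi PsiN linearZ /= !scalerA mulrC.
(* [Psi^h] fixes all points, also those outside the subgeometry, so [x] ranges over the whole of
   [L]. *)
have tauh x : iter h tau x = x.
  have [d] := ordPsi (y2 j1 x *m E); rewrite bE iterNE.
  rewrite !scalemxAl => /E_inj/rowP dE.
  have bd : b h = d.
    have := dE j0; rewrite !mxE !eqxx !mulr0 !addr0 mulr1.
    have -> : iter h tau 1 = 1 by elim: (h) => //= i ->; rewrite rmorph1.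
    by rewrite mulr1.
  have := dE j1; rewrite !mxE !eqxx /= add0r mulr1 bd; apply: mulfI.
  by rewrite -bd.
(* The test vector of such an [x] spans a fixed point, hence a point of the subgeometry, and [x] is
   a ratio of its coordinates in F. *)
have tau_fix x : tau x = x -> exists c : F, x = c%:A.
  move=> tx; have [|b1 [w yE]] := (fixPsi _ (y2_neq0 j1 x isT)).1.
    exists a0; rewrite PsiE; congr (_ *: (_ *m E)).
    rewrite /y2 map_mxD map_mxZ !map_delta_mx tx //.
  have {}yE : y2 j1 x = b1 *: map_mx (in_alg L) w.
    by apply: E_inj; rewrite yE /embed -scalemxAl.
  have := congr1 (fun y : VL => y 0 j0) yE; rewrite y2_j0 // !mxE /= => b1w.
  have := congr1 (fun y : VL => y 0 j1) yE; rewrite y2_j // !mxE /= => ->.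
  exists (w 0 j1 / w 0 j0).
  have w0 : w 0 j0 != 0.
    apply/eqP => w0; move/eqP: b1w.
    by rewrite w0 scale0r mulr0 oner_eq0.
  apply: (mulIf (_ : (w 0 j0)%:A != 0)); first by rewrite scaler_eq0 negb_or w0 oner_neq0.
  by rewrite mulrAC -b1w mul1r mulr_algl scalerA divfK.
exists N, b; split=> // [x|x].
  split=> [|[w ->]]; last first.
    by rewrite /embed NE; congr (_ *m E); apply/rowP => j; rewrite !mxE tauF.
  rewrite -[x](mulmxKV Eu) NE => /E_inj/rowP yE.
  have /fin_all_exists[c cE] j : exists c : F, (x *m invmx E) 0 j = c%:A.
    by apply: tau_fix; have := yE j; rewrite [X in X = _ -> _]mxE.
  by exists (\row_j c j); congr (_ *m E); apply/rowP => j; rewrite cE !mxE.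
rewrite -[x](mulmxKV Eu) iterNE; congr (_ *m E).
by apply/rowP => j; rewrite mxE tauh.
Qed.
End SemilinearNormalForm.

(** * Field models of Desarguesian spreads *)

Section Coordinates.
Variables (F : finFieldType) (L : fieldExtType F) (k h : nat).
Local Notation n := (k * h)%N.
Local Notation V := 'rV[F]_n.
Local Notation VL := 'rV[L]_n.

Lemma orbit_spanP (f : VL -> VL) (u x : VL) :
  reflect (exists c : 'I_h -> L, x = \sum_(i < h) c i *: iter i f u)
    (x \in orbit_span f u).
Proof.
have iotaE : iota 0 h = index_iota 0 h by rewrite /index_iota subn0.
rewrite /orbit_span span_def big_map iotaE big_mkord.
apply: (iffP memv_sumP) => [[y yP ->]|[c ->]].
  have /fin_all_exists[c cE] i : exists c : L, y i = c *: iter i f u.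
    by have /vlineP := yP i isT.
  by exists c; apply: eq_bigr.
by exists (fun i => c i *: iter i f u) => // i _; rewrite memvZ ?memv_line.
Qed.

Lemma mem_semilinear_img (tau : {rmorphism L -> L})
    (Psi : {linear VL -> VL | tau \; *:%R}) i (U : {vspace VL}) x :
  x \in U -> iter i Psi x \in semilinear_img (iter i Psi) U.
Proof.
move=> /coord_vbasis ->.
have -> (d : nat) (c : 'I_d -> L) (y : 'I_d -> VL) :
    iter i Psi (\sum_j c j *: y j) = \sum_j iter i tau (c j) *: iter i Psi (y j).
  elim: i => //= i ->; rewrite linear_sum; apply: eq_bigr => j _.
  by rewrite linearZ.
apply: memv_suml => j _; apply/memvZ/memv_span/map_f.
by rewrite mem_nth ?size_tuple.
Qed.

Lemma embed_inj (E : 'M[L]_n) : E \in unitmx -> injective (embed E).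
Proof.
by move=> Eu x y /(can_inj (mulmxK Eu))/map_mx_inj.
Qed.

Lemma embed_linear (E : 'M[L]_n) (c : F) x y :
  embed E (c *: x + y) = c%:A *: embed E x + embed E y.
Proof. by rewrite /embed map_mxD map_mxZ mulmxDl -scalemxAl. Qed.

(** The conjugates of [Theta] form a direct sum, so a trace determines its component in [Theta].
    This makes [phi] injective and identifies the images of L-lines with the traces of the orbit
    spans on the subgeometry. *)
Lemma L_spread_field_model (S : {fset {vspace V}}) :
  \dim {:L} = h -> (1 < n)%N -> L_spread L S ->
  exists phi : 'rV[L]_k -> V, field_model phi S.
Proof.
move=> dimL n_gt1 [E [tau [Psi [Theta [Eu [bijPsi ordPsi fixPsi] dimT sumT memS]]]]].
have [N [b [b0 bE tauF fixN Nh]]] :=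
  semilinear_normal_form n_gt1 Eu (bij_inj bijPsi) ordPsi fixPsi.
pose U (i : 'I_h) := semilinear_img (iter i Psi) Theta.
(* Dimension count: [h] summands of dimension at most [k] span a space of dimension [k * h]. *)
have dirU : directv (\sum_i U i).
  rewrite directvEgeq /= sumT dimvf /dim /= mul1n.
  have le_k i : (\dim (U i) <= k)%N.
    by rewrite (leq_trans (dim_span _)) // size_map size_tuple dimT.
  apply: (leq_trans (leq_sum _ (fun i _ => le_k i))).
  by rewrite sum_nat_const card_ord mulnC.
have NU (i : 'I_h) t : t \in Theta -> iter i N t \in U i.
  move=> /(mem_semilinear_img Psi i); rewrite bE => Nt.
  by rewrite -[iter i N t](scalerK (b0 i)) memvZ.
(* Index 0, whose conjugate is [Theta] itself. *)
pose i0 : 'I_h := cast_ord dimL (Ordinal (adim_gt0 {:L}%AS)).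
have [B Bbas] : exists B : k.-tuple VL, basis_of Theta B.
  by exists (tcast dimT (vbasis Theta)); rewrite val_tcast vbasisP.
pose m (v : 'rV[L]_k) := \sum_j v 0 j *: B`_j.
have mT v : m v \in Theta.
  by apply: memv_suml => j _; rewrite memvZ // (basis_mem Bbas) // mem_nth ?size_tuple.
have m_lin c u v : m (c *: u + v) = c *: m u + m v.
  rewrite scaler_sumr -big_split; apply: eq_bigr => j _ /=.
  by rewrite !mxE scalerDl scalerA.
have m0 : m 0 = 0 by apply: big1 => j _; rewrite mxE scale0r.
have mZ c u : m (c *: u) = c *: m u by rewrite -[c *: u]addr0 m_lin m0 addr0.
have m_inj : injective m.
  move=> u v muv; apply/rowP => j.
  have := congr1 (coord B j) muv.
  by rewrite !coord_sum_free ?(basis_free Bbas).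
have mP t : t \in Theta -> exists v, t = m v.
  move=> tT; exists (\row_j coord B j t).
  rewrite {1}(coord_basis Bbas tT); apply: eq_bigr => j _.
  by rewrite mxE.
clearbody m; pose trN x := \sum_(i < h) iter i N x.
have iterND i x y : iter i N (x + y) = iter i N x + iter i N y.
  by elim: i => //= i ->; rewrite linearD.
have iterNZ i c x : iter i N (c *: x) = iter i tau c *: iter i N x.
  by elim: i => //= i ->; rewrite linearZ.
(* Since [N^h] is the identity, both sides become the sum of the iterates 0 to [h] once [x] is
   added. *)
have N_trN x : N (trN x) = trN x.
  apply: (addrI x); rewrite /trN linear_sum /=.
  have := @big_ord_recr _ 0 +%R h (fun i => iter i N x).
  by rewrite big_ord_recl /= Nh => ->; rewrite addrC.
have ex_phi v : exists w, embed E w == trN (m v).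
  by have [w ->] := (fixN (trN (m v))).1 (N_trN (m v)); exists w.
pose phi v : V := xchoose (ex_phi v).
have phiE v : embed E (phi v) = trN (m v) by exact/eqP/(xchooseP (ex_phi v)).
have trN_head (c : 'I_h -> L) u v :
    trN (m v) = \sum_(i < h) c i *: iter i N (m u) -> v = c i0 *: u.
  move/eqP; have /directv_sum_unique -> // := dirU => [|i _|i _].
  - move=> /forall_inP/(_ i0 isT)/eqP /= vu; apply: m_inj.
    by rewrite mZ.
  - exact: NU.
  by rewrite memvZ ?NU.
have phi_lin : F_linear phi.
  move=> c u v; apply: (embed_inj Eu); rewrite embed_linear !phiE m_lin /trN.
  rewrite scaler_sumr -[RHS]big_split; apply: eq_bigr => i _ /=.
  rewrite iterND iterNZ; congr (_ *: _ + _).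
  by elim: (nat_of_ord i) => //= d ->; rewrite tauF.
have phi_inj : injective phi.
  move=> u v uv; rewrite -[v]scale1r; apply: (trN_head (fun=> 1)).
  rewrite -phiE uv phiE /trN.
  by apply: eq_bigr => i _; rewrite scale1r.
(* Injectivity suffices, as [L^k] and [V] both have [#|F| ^ (k * h)] elements. *)
have phi_bij : bijective phi.
  pose T := finvect_type L.
  apply: (@inj_card_bij 'rV[T]_k V phi phi_inj).
  rewrite !card_mx !mul1n -(card_vspacef (Vector.class (T : vectType F))).
  by rewrite card_vspace dimL -expnM mulnC.
have line_orbit v w : (w \in L_line phi v) = (embed E w \in orbit_span Psi (m v)).
  apply/(mem_L_line phi_lin)/orbit_spanP => [[a ->]|[c wE]].
    exists (fun i => iter i tau a / b i); rewrite phiE mZ /trN; apply: eq_bigr => i _.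
    by rewrite iterNZ bE scalerA divfK.
  (* The preimage of [w] is read off from the component of [embed E w] in [Theta]; the factor [b i0]
     converts [Psi] into [N]. *)
  have [g phiK gK] := phi_bij; exists (c i0 * b i0).
  rewrite -[w]gK; congr phi.
  apply: (trN_head (fun i => c i * b i)).
  rewrite -phiE gK wE; apply: eq_bigr => i _.
  by rewrite bE scalerA.
exists phi; split=> // W; rewrite memS; split.
  move=> [u [/mP[v ->] u0 Wu]]; exists v.
    by apply: contra_neq u0 => ->.
  by apply/vspaceP => w; rewrite Wu line_orbit.
move=> [v v0 ->]; exists (m v); split=> //.
by apply: contra_neq v0 => mv; apply: m_inj; rewrite m0.
Qed.

Lemma desarguesian_field_model (D : {fset {vspace V}}) :
  \dim {:L} = h -> (1 < n)%N -> desarguesian_spread L D ->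
  exists phi : 'rV[L]_k -> V, field_model phi D.
Proof.
move=> dimL n_gt1 [_ [S [g [S_L g_inj ->]]]].
have [phi [lin bij memS]] := L_spread_field_model dimL n_gt1 S_L.
have glin : F_linear (g \o phi) by move=> c u v /=; rewrite lin linearP.
have lineE v : L_line (g \o phi) v = (g @: L_line phi v)%VS.
  apply/vspaceP => w; apply/(mem_L_line glin)/memv_imgP => [[a ->]|[x]].
    by exists (phi (a *: v)) => //; apply/(mem_L_line lin); exists a.
  by move=> /(mem_L_line lin)[a ->] ->; exists a.
exists (g \o phi); split=> //.
  apply: bij_comp bij; exists (g^-1)%VF => x; last by rewrite lker0_lfunVK.
  by rewrite lker0_lfunK.
move=> W; split=> [/imfsetP[W' /memS[v v0 ->] ->]|[v v0 ->]].
  by exists v => //; rewrite lineE.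
by rewrite lineE; apply/imfsetP; exists (L_line phi v) => //; apply/memS; exists v.
Qed.
End Coordinates.

(** * The subfield attached to an F-linear map of [L] *)

Section Multiplicative.
Variables (F : finFieldType) (L : fieldExtType F).

(** This is the K of the overview, written as an intersection of kernels so that it is a subspace;
    [finvect_type L] provides a finite index set. *)
Definition mult_space (A : 'End(L)) : {vspace L} :=
  (\bigcap_(l : finvect_type L) lker ((A \o amull (l : L)) - (amull (A l) \o A))%VF)%VS.

Lemma mult_spaceP (A : 'End(L)) x :
  reflect (forall l, A (l * x) = A l * A x) (x \in mult_space A).
Proof.
have kerE l : (x \in lker ((A \o amull l) - (amull (A l) \o A))%VF) =
    (A (l * x) == A l * A x).
  by rewrite memv_ker !lfun_simp /= subr_eq0.
rewrite memvE; apply: (iffP subv_bigcapP) => [Ax l | Ax l _].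
  by apply/eqP; rewrite -kerE memvE; exact: (Ax l isT).
by rewrite -memvE kerE Ax.
Qed.

(** Closure under products: A(l x y) = A(l x) A(y) = A(l) A(x) A(y) = A(l) A(x y). *)
Lemma mult_space_is_aspace (A : 'End(L)) : A 1 = 1 -> is_aspace (mult_space A).
Proof.
move=> A1; apply/andP; split.
  by apply/has_algid1/mult_spaceP => l; rewrite A1 !mulr1.
apply/prodvP => x y /mult_spaceP Ax /mult_spaceP Ay.
by apply/mult_spaceP => l; rewrite mulrA Ay Ax -mulrA -Ay.
Qed.

End Multiplicative.

(** * Common elements of two models related by an entrywise map *)

Section Intersection.
Variables (F : finFieldType) (L : fieldExtType F) (k n : nat).
Local Notation V := 'rV[F]_n.
Variables (D D' : {fset {vspace V}}) (phi phi' : 'rV[L]_k -> V) (A : 'End(L)).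
Hypotheses (k_gt0 : (0 < k)%N) (phiD : field_model phi D)
  (phiD' : field_model phi' D').
Hypotheses (A1 : A 1 = 1) (A_phi : forall x, phi' (map_mx A x) = phi x).

Lemma twist_inj : lker A == 0%VS.
Proof.
have [lin /bij_inj inj _] := phiD.
apply/lker0P => x y Axy; pose i := Ordinal k_gt0.
have : const_mx x = const_mx y :> 'rV_k by apply: inj; rewrite -!A_phi !map_const_mx Axy.
by move/matrixP/(_ 0 i); rewrite !mxE.
Qed.

Lemma mem_modelsI W :
  W \in D `&` D' <-> exists v : 'rV[L]_k,
    [/\ v != 0, forall j, v 0 j \in mult_space A & W = L_line phi v].
Proof.
rewrite inE.
have [lin /bij_inj inj memD] := phiD; have [lin' /bij_inj inj' memD'] := phiD'.
have A0 x : (A x == 0) = (x == 0).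
  by rewrite -[RHS](inj_eq (lker0P twist_inj)) linear0.
split=> [/andP[/memD[u u0 Wu] /memD'[u' u'0 Wu']] | [v [v0 vK Wv]]]; last first.
  (* For [v] over K, the entrywise map sends the line of [v] into that of [map_mx A v], and onto it
     because [A] is bijective. *)
  have AZ a : map_mx A (a *: v) = A a *: map_mx A v.
    by apply/rowP => j; rewrite !mxE; apply/mult_spaceP.
  apply/andP; split; first by apply/memD; exists v.
  apply/memD'; exists (map_mx A v).
    apply: contra_neq v0 => Av0; apply/rowP => j; apply/eqP.
    by rewrite [X in _ == X]mxE -A0; have /rowP/(_ j) := Av0; rewrite !mxE => ->.
  rewrite Wv; apply/vspaceP => w; apply/(mem_L_line lin)/(mem_L_line lin') => -[a ->].
    by exists (A a); rewrite -A_phi AZ.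
  by exists ((A^-1)%VF a); rewrite -A_phi AZ lker0_lfunVK ?twist_inj.
have [j uj0] : exists j, u 0 j != 0.
  apply/existsP; apply: contra_neqT u0; rewrite negb_exists => /forallP u0.
  by apply/rowP => j; rewrite mxE; apply/eqP; have := u0 j; rewrite negbK.
(* With a coordinate equal to 1 and [A 1 = 1], the scalar relating [map_mx A (l *: v)] to
   [map_mx A v] must be [A l]. *)
pose v := (u 0 j)^-1 *: u.
have vj : v 0 j = 1 by rewrite mxE mulVf.
have Wv : W = L_line phi v by rewrite (L_line_scale lin) ?invr_eq0.
clearbody v; have AvP l : exists c, map_mx A (l *: v) = c *: u'.
  have : phi (l *: v) \in W by rewrite Wv; apply/(mem_L_line lin); exists l.
  by rewrite Wu' -A_phi => /(mem_L_line lin')[c /inj' ->]; exists c.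
have [b Ab] := AvP 1; rewrite scale1r in Ab.
exists v; split=> // [|i].
  by apply: contra_eq_neq vj => ->; rewrite mxE eq_sym oner_eq0.
have b0 : b != 0.
  apply/eqP => b0; have /rowP/(_ j)/eqP := Ab.
  by rewrite b0 !mxE mul0r vj A1 oner_eq0.
apply/mult_spaceP => l; have [c Ac] := AvP l.
have {Ac} Ac : map_mx A (l *: v) = (c / b) *: map_mx A v.
  by rewrite Ac Ab scalerA divfK.
have <- : c / b = A l.
  by have /rowP/(_ j) := Ac; rewrite !mxE vj mulr1 A1 mulr1.
by have /rowP/(_ i) := Ac; rewrite !mxE.
Qed.

(** When K is [L], each element of [D] lies in [D']. Conversely, an element of [D'] shares a nonzero
    vector with some element of [D]; the latter is also in [D'], and two lines of one model with a
    common nonzero vector coincide. *)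
Lemma models_eq : mult_space A = fullv -> D = D'.
Proof.
move=> K1; have [lin bij memD] := phiD; have [lin' bij' memD'] := phiD'.
have sDD' W : W \in D -> W \in D'.
  move=> WD; suff: W \in D `&` D' by rewrite inE WD.
  apply/mem_modelsI; have /memD[v v0 Wv] := WD.
  by exists v; split=> // j; rewrite K1 memvf.
apply/fsetP => W; apply/idP/idP => [/sDD' //|WD'].
have /memD'[v' v'0 ->] := WD'.
have [g phiK gK] := bij; pose v := g (phi' v').
have v0 : v != 0.
  apply: contra_neq v'0 => v0; apply: (bij_inj bij').
  by rewrite -(gK (phi' v')) -/v v0 (F_linear0 lin) (F_linear0 lin').
have WD : L_line phi v \in D by apply/memD; exists v.
suff -> : L_line phi' v' = L_line phi v by [].
have /sDD'/memD'[u' u'0 Wu'] := WD.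
have := L_line_mem lin v; rewrite Wu' gK => /(mem_L_line lin')[a /(bij_inj bij') v'a].
rewrite v'a L_line_scale //.
by apply: contra_neq v'0 => a0; rewrite v'a a0 scale0r.
Qed.

End Intersection.

(** * Moving a frame to the standard frame *)

Section Frames.
Variables (F : finFieldType) (L : fieldExtType F) (k n : nat).
Local Notation V := 'rV[F]_n.
Local Notation LK := 'rV[L]_k.

Lemma F_linear_mulmx (phi : LK -> V) (M : 'M[L]_k) :
  F_linear phi -> F_linear (fun x => phi (x *m M)).
Proof. by move=> lin c u v /=; rewrite mulmxDl -scalemxAl lin. Qed.

Lemma L_line_mulmx (phi : LK -> V) (M : 'M[L]_k) v : F_linear phi ->
  L_line (fun x => phi (x *m M)) v = L_line phi (v *m M).
Proof.
move=> lin; apply/vspaceP => w.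
apply/(mem_L_line (F_linear_mulmx M lin))/(mem_L_line lin) => -[a ->].
  by exists a; rewrite scalemxAl.
by exists a; rewrite scalemxAl.
Qed.

Lemma field_model_mulmx (phi : LK -> V) D (M : 'M[L]_k) :
  M \in unitmx -> field_model phi D -> field_model (fun x => phi (x *m M)) D.
Proof.
move=> Mu [lin bij memD]; split.
- exact: F_linear_mulmx.
- apply: (bij_comp bij).
  by exists (mulmxr (invmx M)) => x /=; rewrite ?mulmxK ?mulmxKV.
move=> W; rewrite memD; split=> -[v v0 ->].
  exists (v *m invmx M); last by rewrite L_line_mulmx // mulmxKV.
  by apply: contra_neq v0 => v0; rewrite -[v](mulmxKV Mu) v0 mul0mx.
exists (v *m M); last by rewrite L_line_mulmx.
by apply: contra_neq v0 => v0; rewrite -[v](mulmxK Mu) v0 mul0mx.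
Qed.

Definition maps_frame (phi : LK -> V) (Q : 'I_k.+1 -> {vspace V}) : Prop :=
  (forall i : 'I_k, Q (lift ord_max i) = L_line phi (delta_mx 0 i)) /\
  Q ord_max = L_line phi (const_mx 1).

(** The first [k] vectors form a basis of [L^k]. Scaling them by the coordinates [c] of the last
    vector makes that vector their sum, and the change of basis is invertible because no entry of
    [c] vanishes. *)
Lemma exists_maps_frame (phi : LK -> V) D (Q : 'I_k.+1 -> {vspace V}) :
  field_model phi D -> (forall j, Q j \in D) ->
  (forall j0, (\sum_(j | j != j0) Q j)%VS = fullv) ->
  exists2 psi : LK -> V, field_model psi D & maps_frame psi Q.
Proof.
move=> phiD QD Qfull; have [lin bij memD] := phiD.
have /fin_all_exists[u Qu] j : exists u : LK, Q j = L_line phi u.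
  by have /memD[u _ Qj] := QD j; exists u.
have span_u j0 v : exists c : 'I_k.+1 -> L, v = \sum_(j | j != j0) c j *: u j.
  have : phi v \in (\sum_(j | j != j0) Q j)%VS by rewrite Qfull memvf.
  case/memv_sumP => w Qw phiv.
  have /fin_all_exists[c cP] j : exists c : L, j != j0 -> w j = phi (c *: u j).
    case: (eqVneq j j0) => [_|jj0]; first by exists 0.
    by have := Qw j jj0; rewrite Qu => /(mem_L_line lin)[c ->]; exists c.
  exists c; apply: (bij_inj bij); rewrite phiv (F_linear_sum lin).
  exact: eq_bigr.
pose U := \matrix_(i < k) u (lift ord_max i).
have rowU i : row i U = u (lift ord_max i) by rewrite rowK.
have Uu : U \in unitmx.
  rewrite -row_full_unit -sub1mx; apply/row_subP => i.
  have [c ->] := span_u ord_max (row i 1%:M).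
  apply: summx_sub => j; case: (unliftP ord_max j) => [i' ->|->]; last by rewrite eqxx.
  by move=> _; rewrite -rowU scalemx_sub ?row_sub.
pose c := u ord_max *m invmx U.
have uUi i : u (lift ord_max i) *m invmx U = delta_mx 0 i.
  by rewrite -rowU -row_mul mulmxV // row1.
(* Otherwise all the vectors except the [i]-th would have [i]-th coordinate 0 and could not span
   it. *)
have c0 i : c 0 i != 0.
  apply/eqP => ci; have [b ub] := span_u (lift ord_max i) (u (lift ord_max i)).
  have := congr1 (fun x => (x *m invmx U) 0 i) ub.
  rewrite uUi mulmx_suml summxE big1 => [|j ji].
    by rewrite mxE !eqxx => /eqP; rewrite oner_eq0.
  rewrite -scalemxAl mxE; case: (unliftP ord_max j) ji => [i' ->|->] ji.
    rewrite uUi mxE eqxx eq_sym (inj_eq lift_inj) in ji *.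
    by rewrite (negPf ji) mulr0.
  by rewrite -/c ci mulr0.
have Mu : diag_mx c *m U \in unitmx.
  rewrite unitmx_mul Uu andbT unitmxE det_diag unitfE.
  by apply/prodf_neq0 => i _; exact: c0.
exists (fun x => phi (x *m (diag_mx c *m U))); first exact: field_model_mulmx.
split=> [i|]; rewrite L_line_mulmx // Qu.
  have -> : delta_mx 0 i *m (diag_mx c *m U) = c 0 i *: u (lift ord_max i).
    rewrite -rowE mul_diag_mx -rowU; apply/rowP => j.
    by rewrite !mxE.
  by rewrite L_line_scale.
rewrite mulmxA mul_mx_diag; congr (L_line phi _).
rewrite -[LHS](mulmxKV Uu) -/c; congr (_ *m _).
by apply/rowP => j; rewrite !mxE mul1r.
Qed.
End Frames.

(** * Comparison of two models with the same frame *)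

Section Twist.
Variables (F : finFieldType) (L : fieldExtType F) (k n : nat).
Local Notation V := 'rV[F]_n.

Lemma exists_twist (D D' : {fset {vspace V}}) (Q : 'I_k.+1 -> {vspace V})
    (phi phi' : 'rV[L]_k -> V) :
  (0 < k)%N -> field_model phi D -> field_model phi' D' ->
  maps_frame phi Q -> maps_frame phi' Q ->
  exists (psi : 'rV[L]_k -> V) (A : 'End(L)),
    [/\ field_model psi D', A 1 = 1 & forall x, psi (map_mx A x) = phi x].
Proof.
move=> k_gt0 phiD phiD' [Qe Q1] [Qe' Q1']; pose i0 := Ordinal k_gt0.
have [lin bij _] := phiD; have [lin' bij' _] := phiD'; have [g gK Kg] := bij'.
pose f x := g (phi x).
have f_lin c u v : f (c%:A *: u + v) = c%:A *: f u + f v.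
  by apply: (bij_inj bij'); rewrite lin' !Kg lin.
have fD : {morph f : u v / u + v}.
  by move=> u v; apply: (bij_inj bij'); rewrite (F_linearD lin') !Kg (F_linearD lin).
have f0 : f 0 = 0.
  by apply: (bij_inj bij'); rewrite Kg (F_linear0 lin) (F_linear0 lin').
pose A0 a := f (const_mx a) 0 i0.
have f1 a : f (const_mx a) = const_mx (A0 a).
  have : phi (const_mx a) \in Q ord_max.
    rewrite Q1; apply/(mem_L_line lin); exists a; congr phi.
    by apply/rowP => j; rewrite !mxE mulr1.
  rewrite Q1' => /(mem_L_line lin')[b fa].
  have {}fa : f (const_mx a) = const_mx b.
    by apply: (bij_inj bij'); rewrite Kg fa; congr phi'; apply/rowP => j; rewrite !mxE mulr1.
  by rewrite /A0 fa mxE.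
have fe a i : exists b, f (a *: delta_mx 0 i) = b *: delta_mx 0 i.
  have : phi (a *: delta_mx 0 i) \in Q (lift ord_max i).
    by rewrite Qe; apply/(mem_L_line lin); exists a.
  rewrite Qe' => /(mem_L_line lin')[b fa]; exists b.
  by apply: (bij_inj bij'); rewrite Kg.
have fE (x : 'rV_k) : f x = \sum_i f (x 0 i *: delta_mx 0 i).
  by rewrite [in LHS](row_sum_delta x) (big_morph f fD f0).
(* The scalars found for the various [i] agree: they are the entries of the image of a constant
   vector, which is constant. *)
have fA a i : f (a *: delta_mx 0 i) = A0 a *: delta_mx 0 i.
  have /fin_all_exists[b fb] := fe a; rewrite fb; congr (_ *: _).
  have <- : f (const_mx a) 0 i = A0 a by rewrite f1 mxE.
    rewrite fE (eq_bigr (fun j => b j *: delta_mx 0 j)) => [|j _]; last by rewrite mxE fb.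
  rewrite summxE (bigD1 i) //= !mxE !eqxx mulr1 big1 ?addr0 // => j ji.
  by rewrite !mxE eqxx eq_sym (negPf ji) mulr0.
have {}fE x : f x = map_mx A0 x.
  rewrite fE (eq_bigr (fun i => A0 (x 0 i) *: delta_mx 0 i)) => [|i _]; last exact: fA.
  by rewrite [RHS]row_sum_delta; apply: eq_bigr => i _; rewrite mxE.
have A0lin : linear A0.
  move=> c a b; rewrite /A0.
  have -> : const_mx (c *: a + b) = c%:A *: const_mx a + const_mx b :> 'rV_k.
    by apply/rowP => j; rewrite !mxE mulr_algl.
  by rewrite f_lin !mxE mulr_algl.
(* To obtain [A 1 = 1], the scalar [c] is moved from [A0] into the second model, whose lines it
   preserves. *)
pose c := A0 1.
have c0 : c != 0.
  apply/eqP => c0.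
  have : const_mx 1 = 0 :> 'rV[L]_k.
    apply: (bij_inj bij); rewrite -[LHS]Kg -/(f _) f1 -/c c0.
    rewrite (F_linear0 lin) -(F_linear0 lin'); congr phi'.
  by move/rowP/(_ i0)/eqP; rewrite !mxE oner_eq0.
have Alin : linear (fun a => c^-1 * A0 a).
  by move=> d a b; rewrite A0lin mulrDr scalerAr.
pose AM := GRing.isLinear.Build F L L *:%R _ Alin.
pose A : {linear L -> L} := HB.pack (fun a => c^-1 * A0 a) AM.
exists (fun x => phi' (x *m c%:M)), (linfun A); split.
- apply: field_model_mulmx phiD'.
  by rewrite -scalemx1 unitmxZ ?unitmx1 // unitfE.
- by rewrite lfunE /= mulVf.
move=> x; rewrite -[RHS]Kg -/(f _) fE; congr phi'.
rewrite mul_mx_scalar; apply/rowP => j; rewrite !mxE lfunE /=.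
by rewrite mulrA divff // mul1r.
Qed.
End Twist.

(** * Pseudo-arcs of size [k + 1] as indexed frames *)

Section PseudoArc.
Variables (F : finFieldType) (k h : nat).
Local Notation V := 'rV[F]_(k * h).

Lemma pseudo_arc_enum (P : {fset {vspace V}}) :
  pseudo_arc P -> #|` P| = k.+1 ->
  exists2 Q : 'I_k.+1 -> {vspace V}, forall j, Q j \in P &
    forall j0, (\sum_(j | j != j0) Q j)%VS = fullv.
Proof.
(* The default [0%VS] is never reached, since the enumeration has [k.+1] entries. *)
move=> [_ arcP] cP; pose Q (j : 'I_k.+1) := nth 0%VS (enum_fset P) j.
have QP j : Q j \in P by apply: mem_nth; rewrite cP ltn_ord.
exists Q => // j0.
have sub : P `\ Q j0 `<=` P by apply: fsubD1set.
have card : #|` P `\ Q j0| = k.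
  by have := cardfsD1 (Q j0) P; rewrite QP cP add1n => -[].
apply/eqP; rewrite eqEsubv subvf /= -(arcP _ sub card) big_seq.
elim/big_rec: _ => [|W U]; first exact: sub0v.
rewrite in_fsetD1 subv_add => /andP[WQ WP] ->; rewrite andbT.
have ltW : (index W (enum_fset P) < k.+1)%N by rewrite -cP index_mem.
apply: (@sumv_sup _ _ _ (Ordinal ltW)); last by rewrite /Q /= nth_index.
by apply: contraNneq WQ => <-; rewrite /Q /= nth_index.
Qed.

(** For [k = 1] an element of [P] is the whole space, so [P] could not have two elements. *)
Lemma pseudo_arc_gt1 (P : {fset {vspace V}}) :
  (0 < k)%N -> pseudo_arc P -> #|` P| = k.+1 -> (1 < k)%N.
Proof.
case: k P => [|[|//]] P _ [dimP _] cP //.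
have full W : W \in P -> W = fullv.
  by move/dimP => dW; apply/eqP; rewrite eqEdim subvf dimvf dW /dim /= !mul1n.
suff : (#|` P| <= 1)%N by rewrite cP.
have /fsubset_leq_card : P `<=` [fset fullv].
  by apply/fsubsetP => W /full ->; rewrite inE.
by rewrite cardfs1.
Qed.
End PseudoArc.

(** * Counting the lines spanned by vectors over a subfield *)

Section Counting.
Variables (F : finFieldType) (L : fieldExtType F) (k n : nat).
Local Notation V := 'rV[F]_n.

(** Double counting of the nonzero vectors over [K] against the elements of [X] that they give:
    every element arises from exactly |K| - 1 of them. *)
Lemma card_subfield_lines (K : {subfield L}) (phi : 'rV[L]_k -> V)
    (X : {fset {vspace V}}) :
  F_linear phi -> injective phi ->
  (forall W, W \in X <-> exists v : 'rV[L]_k,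
    [/\ v != 0, forall j, v 0 j \in K & W = L_line phi v]) ->
  #|` X| = ((#|F| ^ (k * \dim K) - 1) %/ (#|F| ^ \dim K - 1))%N.
Proof.
move=> lin inj memX.
pose T := finvect_type (subvs_of K).
have cardT : #|T| = (#|F| ^ \dim K)%N.
  by rewrite -(card_vspacef (Vector.class (T : vectType F))) card_vspace dimvf.
pose ext (x : 'rV[T]_k) : 'rV[L]_k := \row_j vsval (x 0 j).
have ext_inj : injective ext.
  by move=> x y /rowP xy; apply/rowP => j; apply: val_inj; have := xy j; rewrite !mxE.
have ext0 : ext 0 = 0 by apply/rowP => j; rewrite !mxE.
have extZ (a : T) x : ext (a *: x) = vsval a *: ext x.
  by apply/rowP => j; rewrite !mxE.
have ext_eq0 x : (ext x == 0) = (x == 0) by rewrite -(inj_eq ext_inj) ext0.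
have extP (v : 'rV[L]_k) : (forall j, v 0 j \in K) -> exists x, v = ext x.
  move=> vK; exists (\row_j Subvs (vK j)).
  by apply/rowP => j; rewrite !mxE.
pose f x := L_line phi (ext x).
have fX (x : 'rV[T]_k) : x != 0 -> f x \in X.
  move=> x0; apply/memX; exists (ext x); split=> //; first by rewrite ext_eq0.
  by move=> j; rewrite mxE subvsP.
(* Two vectors over [K] on one L-line differ by a ratio of entries, hence by a scalar of [K]. *)
have fibre W : W \in X ->
    (\sum_(x : 'rV[T]_k | x != 0%R) (f x == W) = #|T| - 1)%N.
  case/memX => v [v0 /extP[x0 vx0] ->]; rewrite {v}vx0 ext_eq0 in v0 *.
  have scale_inj : injective (fun a : T => a *: x0).
    move=> a b /eqP; rewrite -subr_eq0 -scalerBl scalemx_eq0 (negPf v0) orbF.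
    by rewrite subr_eq0 => /eqP.
  rewrite -big_mkcondr /= sum1_card subn1 -(cardC1 (0 : T)) -(card_image scale_inj).
  apply: eq_card => x; apply/andP/imageP => [[x0' /eqP fx]|[a]].
    have [|a a0 xa] := L_line_inj lin inj _ fx; first by rewrite ext_eq0.
    have /rV0Pn[j x0j] := v0; have {}x0j : vsval (x0 0 j) != 0 by [].
    have aK : a \in K.
      have /rowP/(_ j) := xa; rewrite !mxE => /esym/(canRL (mulfK x0j)) ->.
      by rewrite rpred_div ?subvsP.
    exists (Subvs aK : T); first by rewrite inE.
    by apply: ext_inj; rewrite extZ.
  rewrite !inE => a0 ->; rewrite scalemx_eq0 negb_or a0 v0; split=> //.
  rewrite /f extZ L_line_scale //.
have cardX : (#|` X| * (#|T| - 1) = #|T| ^ k - 1)%N.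
  transitivity (\sum_(W <- X) \sum_(x : 'rV[T]_k | x != 0%R) (f x == W))%N.
    by rewrite (eq_big_seq _ fibre) big_const_seq count_predT iter_addn_0 mulnC.
  rewrite exchange_big /= (eq_bigr (fun=> 1%N)) => [|x x0].
    by rewrite sum1_card (cardC1 (0 : 'rV[T]_k)) card_mx mul1n subn1.
  by rewrite -big_mkcond sum1_count (eq_count (eq_sym _)) count_uniq_mem ?fset_uniq // fX.
rewrite mulnC expnM -cardT -cardX mulnK // subn_gt0 cardT.
by rewrite -[1%N](expn0 #|F|) ltn_exp2l ?adim_gt0 ?finNzRing_gt1.
Qed.
End Counting.

(** * Generalized Segre varieties from lines over a subfield *)

Section Segre.
Variables (F : finFieldType) (L : fieldExtType F) (k h : nat).
Local Notation V := 'rV[F]_(k * h).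

Lemma gen_segre_system_lines (K : {subfield L}) (phi : 'rV[L]_k -> V)
    (X : {fset {vspace V}}) :
  (0 < h)%N -> F_linear phi -> bijective phi ->
  (forall W, W \in X <-> exists v : 'rV[L]_k,
    [/\ v != 0, forall j, v 0 j \in K & W = L_line phi v]) ->
  exists S : {fset {vspace V}}, gen_segre_system L (\dim K) S X.
Proof.
move=> h_gt0 lin bij memX; pose i0 := Ordinal h_gt0.
(* Row 0 carries the exponent [#|F| ^ 0], so it returns [v]; this gives the projectivity from Moore
   matrices to [V]. *)
have row_moore (v : 'rV[L]_k) : row i0 (moore h v) = v.
  by apply/rowP => j; rewrite !mxE expn0 expr1.
pose pts := [fset w : V | (w != 0) && [exists W : X, w \in val W]].
exists [fset <[w]>%VS | w in pts], (fun M => phi (row i0 M)); split.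
- split=> [c A B _ _|w]; first by rewrite -lin linearP.
  have [g phiK gK] := bij; exists (moore h (g w)).
  split; first by rewrite row_moore gK; split=> //; exists (g w).
  by move=> _ [[v ->] <-]; rewrite row_moore phiK.
- move=> W; rewrite memX; split=> -[v [v0 vK piv]]; exists v.
    split=> //; first by exists K.
    by move=> w; rewrite piv; split=> [/(mem_L_line lin)|] [a ->];
      [exists a|apply/(mem_L_line lin); exists a]; rewrite row_moore.
  split=> // [j|].
    (* [K'] is only known to have the dimension of [K]; both consist of the roots in [L] of x^(q^r)
       = x, with q the order of F and r this dimension, so they have the same elements. *)
    case: vK => K' dimK' /(_ j).
    by rewrite !Fermat's_little_theorem dimK'.
  apply/vspaceP => w; apply/idP/(mem_L_line lin) => [/piv|] [a wE].
    by exists a; rewrite wE row_moore.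
  by apply/piv; exists a; rewrite row_moore.
move=> p; split=> [/imfsetP[w] | [dimp [W WX pW]]].
  rewrite !inE /= => /andP[w0 /existsP[W wW]] ->; split; first by rewrite dim_vline w0.
  by exists (val W); [exact: fsvalP | rewrite -memvE].
have w0 : vpick p != 0 by rewrite vpick0 -dimv_eq0 dimp.
apply/imfsetP; exists (vpick p).
  rewrite !inE w0; apply/existsP; exists [` WX].
  by rewrite (subvP pW) ?memv_pick.
by apply/eqP; rewrite eq_sym eqEdim dimp dim_vline w0 -memvE memv_pick.
Qed.
End Segre.

(** * The intersection of two Desarguesian spreads *)

Theorem theorem4p6 (q k h : nat) (F : finFieldType) (L : fieldExtType F)
  (cardF : #|F| = q) (k_gt0 : (0 < k)%N) (h_gt0 : (0 < h)%N)
  (dimL : \dim {:L} = h)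
  (P D D' : {fset {vspace 'rV[F]_(k * h)}})
  (P_arc : pseudo_arc P) (card_P : #|` P| = k.+1)
  (D_des : desarguesian_spread L D) (D'_des : desarguesian_spread L D')
  (D_neq : D <> D') (sPD : P `<=` D `&` D') :
  exists r : nat,
    [/\ (r %| h)%N, (1 <= r < h)%N,
        #|` D `&` D'| = ((q ^ (k * r) - 1) %/ (q ^ r - 1))%N &
        exists S : {fset {vspace 'rV[F]_(k * h)}},
          gen_segre_system L r S (D `&` D')].
Proof.
(* This provides the two coordinates that [semilinear_normal_form] compares. *)
have k_gt1 := pseudo_arc_gt1 k_gt0 P_arc card_P.
have n_gt1 : (1 < k * h)%N by rewrite (leq_trans k_gt1) ?leq_pmulr.
have [Q QP Qfull] := pseudo_arc_enum P_arc card_P.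
have QI j : Q j \in D `&` D' by exact: (fsubsetP sPD).
have QD j : Q j \in D by have := QI j; rewrite inE => /andP[].
have QD' j : Q j \in D' by have := QI j; rewrite inE => /andP[].
have [phi0 phi0D] := desarguesian_field_model dimL n_gt1 D_des.
have [phi0' phi0D'] := desarguesian_field_model dimL n_gt1 D'_des.
have [phi phiD phiQ] := exists_maps_frame phi0D QD Qfull.
have [phi1 phi1D' phi1Q] := exists_maps_frame phi0D' QD' Qfull.
have [psi [A [psiD' A1 Aphi]]] := exists_twist k_gt0 phiD phi1D' phiQ phi1Q.
pose K := ASpace (mult_space_is_aspace A1).
have memI W : W \in D `&` D' <-> exists v : 'rV[L]_k,
    [/\ v != 0, forall j, v 0 j \in K & W = L_line phi v].
  exact: mem_modelsI k_gt0 phiD psiD' A1 Aphi W.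
have [lin bij _] := phiD.
exists (\dim K); split.
- by rewrite -dimL; apply: (@field_dimS _ _ K {:L}%AS); exact: subvf.
- rewrite adim_gt0 /= -dimL ltn_neqAle dimvS ?subvf // andbT.
  (* A subfield of full dimension is [L], and then the spreads coincide. *)
  apply: contra_not_neq D_neq => dimK.
  apply: (models_eq k_gt0 phiD psiD' A1 Aphi).
  by apply/eqP; rewrite eqEdim subvf -dimK /=.
- by rewrite -cardF; apply: card_subfield_lines lin (bij_inj bij) memI.
exact: gen_segre_system_lines lin bij memI.
Qed.
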